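(* Let $G$ be a regular distance magic graph of order $n$, and let $\Gamma$ be an abelian group of order $n$ generated by at most two elements. Then $G$ admits a generating $\Gamma$-magic map.
   Context: Graphs are finite, simple and undirected; $N_G(v)$ is the open neighborhood of $v$. A graph $G$ of order $n$ is distance magic if there is a bijection $\ell\colon V(G)\to\{1,\dots,n\}$ such that the integer $\sum_{u\in N_G(v)}\ell(u)$ is the same for all $v\in V(G)$. For a finite abelian group $\Gamma$, a map $f\colon V(G)\to\Gamma$ is a $\Gamma$-magic map if there is $\gamma\in\Gamma$ with $\sum_{u\in N_G(v)}f(u)=\gamma$ for every $v\in V(G)$; it is generating if the labels $f(v)$, $v\in V(G)$, generate $\Gamma$. *)

(* Defs.v *)
From mathcomp Require Import all_boot all_order all_algebra all_fingroup.

Set Implicit Arguments.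
Unset Strict Implicit.
Unset Printing Implicit Defensive.

(* A finite simple graph is a symmetric irreflexive relation on a finType. *)
Section Graph.

Variables (V : finType) (e : rel V).

Definition open_nbhd (v : V) : {set V} := [set u | e v u].

Definition regular : Prop := exists r : nat, forall v, #|open_nbhd v| = r.

(* Since 'I_n is {0, ..., n - 1}, the label of u is the successor of l u. *)
Definition distance_magic : Prop :=
  exists l : V -> 'I_#|V|,
    bijective l /\
    exists k : nat, forall v, (\sum_(u in open_nbhd v) (l u).+1)%N = k.

Variables (Gamma : finZmodType) (f : V -> Gamma).

Definition magic_map : Prop :=
  exists gamma : Gamma, forall v, (\sum_(u in open_nbhd v) f u)%R = gamma.

(* <<_>> is the subgroup generated in the additive group of Gamma. *)
Definition generating : Prop :=
  <<[set f v | v in V]>>%g = [set: Gamma].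

End Graph.

Definition generated_by_at_most (k : nat) (Gamma : finZmodType) : Prop :=
  exists A : {set Gamma}, #|A| <= k /\ <<A>>%g = [set: Gamma].

(* Main.v *)
Require Import Defs.
From mathcomp Require Import all_boot all_order all_algebra all_fingroup.

(** If [A] is the adjacency matrix and [l] a distance magic labelling, then [A l]
    is constant, and so is [A 1] by regularity. Hence, if [g] and [h] generate
    Gamma, [v |-> l(v) g + h] is a magic map. The vertices labelled 1 and 2 carry
    [g + h] and [2 g + h], and these two elements generate both [g] and [h]. *)

Lemma subset_pair (T : finType) (x0 : T) (A : {set T}) :
  #|A| <= 2 -> exists x y, A \subset [set x; y].
Proof.
(* If [A] has fewer than two elements, [nth] falls back on the default [x0], so the pair may
   strictly contain [A]. *)
rewrite cardE => szA; exists (nth x0 (enum A) 0), (nth x0 (enum A) 1).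
apply/subsetP => z; rewrite -mem_enum !inE.
by case: (enum A) szA => [|x [|y []]] //= _; rewrite !inE // => ->.
Qed.

Lemma magic_map_affine (V : finType) (e : rel V) (Gamma : finZmodType)
    (l : V -> nat) (k : nat) (g h : Gamma) :
  regular e -> (forall v, \sum_(u in open_nbhd e v) l u = k) ->
  magic_map e (fun v => g *+ l v + h)%R.
Proof.
move=> [r deg_r] sum_l; exists (g *+ k + h *+ r)%R => v.
by rewrite big_split /= GRing.sumr_const deg_r GRing.sumrMnr sum_l.
Qed.

Lemma gen_affine (Gamma : finZmodType) (g h : Gamma) (B : {set Gamma}) :
  (g + h)%R \in B -> (g *+ 2 + h)%R \in B -> [set g; h] \subset <<B>>%g.
Proof.
move=> /mem_gen B1 /mem_gen B2.
(* [g] is the second element minus the first; subtracting [g] from the first then leaves [h]. *)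
have Bg : g \in <<B>>%g.
  have := groupM B2 (groupVr B1); rewrite FinRing.zmodMgE FinRing.zmodVgE.
  by rewrite GRing.mulr2n GRing.opprD GRing.addrACA GRing.addrK GRing.addrN GRing.addr0.
have Bh : h \in <<B>>%g.
  by have := groupM (groupVr Bg) B1; rewrite FinRing.zmodMgE FinRing.zmodVgE GRing.addKr.
by apply/subsetP => x; rewrite !inE => /orP[] /eqP->.
Qed.

Theorem theorem4p6 (V : finType) (e : rel V) (Gamma : finZmodType)
  (e_sym : symmetric e) (e_irr : irreflexive e)
  (G_regular : regular e) (G_magic : distance_magic e)
  (Gamma_order : #|Gamma| = #|V|)
  (Gamma_gen : generated_by_at_most 2 Gamma) :
  exists f : V -> Gamma, magic_map e f /\ generating f.
Proof.
have [A [/(subset_pair _ 0%R _)[g [h sAgh]] genA]] := Gamma_gen.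
have [l [[l' _ l'K] [k sum_l]]] := G_magic.
pose f v : Gamma := (g *+ (l v).+1 + h)%R.
exists f; split; first exact: magic_map_affine sum_l.
apply/eqP; rewrite eqEsubset subsetT /=.
(* The label 2 occurs only if the order is at least 2. Otherwise Gamma is trivial, so any subgroup
   is all of it. *)
have [n_le1 | n_gt1] := leqP #|V| 1.
  have/subset_leqif_cards[_ ] : [1 Gamma]%g \subset [set: Gamma] by [].
  rewrite cards1 cardsT Gamma_order eqn_leq n_le1 -Gamma_order.
  have -> : 0 < #|Gamma| by apply/card_gt0P; exists 0%R.
  by move=> /esym/eqP <-; rewrite sub1G.
rewrite -genA gen_subG (subset_trans sAgh) //.
(* Ordinals start at 0, so [i] stands for the label [i.+1]; the labels 1 and 2 come from [i = 0] and
   [i = 1]. *)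
have labelled i (lt_iV : i < #|V|) : (g *+ i.+1 + h)%R \in [set f v | v in V].
  by apply/imsetP; exists (l' (Ordinal lt_iV)); rewrite ?/f ?l'K.
by apply: gen_affine; [exact: (labelled 0 (ltnW n_gt1)) | exact: labelled].
Qed.
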